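(* The space $X_{ius}$ is reflexive.
   Context: Scalars are real, $\mathbb{N}=\{1,2,\dots\}$. $c_{00}$ is the space of finitely supported sequences, with standard basis $(e_n)$, also written $(e_n^* )$ when its elements are viewed as functionals; $f(x)=\langle f,x\rangle=\sum_n f(n)x(n)$, $\|f\|_\infty=\max_n|f(n)|$. $\operatorname{supp}x=\{n:x(n)\ne 0\}$, $\operatorname{range}(x)$ is the smallest interval of $\mathbb{N}$ containing $\operatorname{supp}x$. For sets, $A<B$ means $\max A<\min B$; $x<y$ means $\operatorname{supp}x<\operatorname{supp}y$. For an interval $E\subset\mathbb{N}$, $Ex$ is the restriction of $x$ to $E$. Fix positive integers $m_j,n_j,s_j$ with $m_1=2$, $m_{j+1}=m_j^5$, $n_1=4$, $n_{j+1}=(4n_j)^{s_j}$, $2^{s_j}\ge m_{j+1}^3$. Let $\mathbf{Q}$ be the set of sequences with finite nonempty support, rational coordinates, all of modulus at most $1$, and $\mathbf{Q_s}$ the set of all $(x_1,f_1,\dots,x_n,f_n)$ with $x_i,f_i\in\mathbf{Q}$ and $\operatorname{range}(x_i)\cup\operatorname{range}(f_i)<\operatorname{range}(x_{i+1})\cup\operatorname{range}(f_{i+1})$ for $i<n$. Fix an injection $\sigma:\mathbf{Q_s}\to\{2j:j\in\mathbb{N}\}$ such that for every $\phi=(x_1,f_1,\dots,x_n,f_n)\in\mathbf{Q_s}$: $\sigma(x_1,f_1,\dots,x_{n-1},f_{n-1})<\sigma(\phi)$ and $\max\{\operatorname{range}(x_n)\cup\operatorname{range}(f_n)\}\le m_{\sigma(\phi)}^{1/2}$.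 Special sequences: $\phi=(x_1,f_1,\dots,x_{2k},f_{2k})\in\mathbf{Q_s}$, with $\phi_i=(x_1,f_1,\dots,x_i,f_i)$, is a special sequence of length $2k$ if: (1) for some $j\in\mathbb{N}$ with $m_{2j}^{1/2}>2k$, $x_1=\frac1{n_{2j}}\sum_{l=1}^{n_{2j}}e_{1,l}$ and $f_1=\frac1{m_{2j}}\sum_{l=1}^{n_{2j}}e^*_{1,l}$, where $(e_{1,l})_l$ are $n_{2j}$ distinct standard basis vectors; (2) for $1\le i\le k$, $\|f_{2i}\|_\infty\le\frac1{m_{\sigma(\phi_{2i-1})}}$ and $|f_{2i}(x_{2i})|\le\frac1{m_{\sigma(\phi_{2i-1})}}$; (3) for $1\le i<k$, with $p=\sigma(\phi_{2i})$, $x_{2i+1}=\frac1{n_p}\sum_{l=1}^{n_p}e_{2i+1,l}$ and $f_{2i+1}=\frac1{m_p}\sum_{l=1}^{n_p}e^*_{2i+1,l}$, where $(e_{2i+1,l})_l$ are $n_p$ distinct standard basis vectors. Norming set: $K_0=K_0^0=\{\pm e_n^*:n\in\mathbb{N}\}$, $K_0^j=\emptyset$ for $j\ge1$, and $K_n^0=K_0$ for all $n$. For $n\ge1$, $j\in\mathbb{N}$: $K_n^{2j}=K_{n-1}^{2j}\cup\{\frac1{m_{2j}}\sum_{i=1}^d f_i:d\le n_{2j},\ f_1<\dots<f_d,\ f_i\in K_{n-1}\}$. For a special sequence $\phi=(x_1,f_1,\dots,x_{n_{2j+1}},f_{n_{2j+1}})$ of length $n_{2j+1}$ with $f_{2i}\in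 K_{n-1}^{\sigma(\phi_{2i-1})}$ for $i\le n_{2j+1}/2$, $K_{n,\phi}^{2j+1}$ is the set of all $\frac{\pm1}{m_{2j+1}}E\bigl(\sum_{i=1}^{n_{2j+1}/2}(\lambda_{f'_{2i}}f_{2i-1}+f'_{2i})\bigr)$, where $E$ is an interval, $f'_{2i}\in K_{n-1}^{\sigma(\phi_{2i-1})}$, $\operatorname{supp}f'_{2i}=\operatorname{supp}f_{2i}$, $|g(x_{2i})|\le\frac1{m_{\sigma(\phi_{2i-1})}}$ for all $g\in K_{n-1}^{\sigma(\phi_{2i-1})}$, and $\lambda_{f'_{2i}}=f'_{2i}(m_{\sigma(\phi_{2i-1})}x_{2i})$ if $f'_{2i}(x_{2i})\ne0$, $\lambda_{f'_{2i}}=\pm\frac1{n_{2j+1}^2}$ otherwise. $K_n^{2j+1}$ is the union of $K_{n-1}^{2j+1}$ and all $K_{n,\phi}^{2j+1}$, $\phi$ a special sequence of length $n_{2j+1}$. $K_n=\bigcup_jK_n^j$, $K=\bigcup_nK_n$. $X_{ius}$ is the completion of $c_{00}$ under $\|x\|=\|x\|_K=\sup\{f(x):f\in K\}$. *)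

(* Defs.v *)
From HB Require Import structures.
From mathcomp Require Import all_boot all_order all_algebra.
From mathcomp Require Import all_classical all_reals all_analysis.

Set Implicit Arguments.
Unset Strict Implicit.
Unset Printing Implicit Defensive.

Import Order.TTheory GRing.Theory Num.Theory.
Import numFieldNormedType.Exports.

Local Open Scope classical_set_scope.
Local Open Scope ring_scope.

Section Dual.
Context {R : realType} (X : normedModType R).

Definition dual_pred : {pred X -> R^o} :=
  fun f => `[< linear f /\ continuous f >].

Lemma dual_submod_closed : submod_closed dual_pred.
Proof.
split.
  apply/asboolP; split; last by move=> x; exact: cvg_cst.
  by move=> a x y; rewrite scaler0 addr0.
move=> a f g /asboolP[lf cf] /asboolP[lg cg]; apply/asboolP; split.
  move=> b x y; have -> : forall z, (a *: f + g) z = a *: f z + g z by [].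
  rewrite lf lg !scalerDr !scalerA (mulrC a b) -!addrA; congr (_ + _).
  by rewrite addrCA.
move=> x; have -> : (a *: f + g) = (fun z => a *: f z + g z) by [].
by apply: cvgD; [apply: cvgZl_tmp; exact: cf | exact: cg].
Qed.

HB.instance Definition _ :=
  GRing.isSubmodClosed.Build R (X -> R^o) dual_pred dual_submod_closed.

Record dual := Dual { dual_val :> X -> R^o; _ : dual_val \in dual_pred }.

HB.instance Definition _ := [isSub for dual_val].
HB.instance Definition _ := [Choice of dual by <:].
HB.instance Definition _ := [SubChoice_isSubLmodule of dual by <:].

Lemma dual_linear (f : dual) : linear (f : X -> R^o).
Proof. by have /asboolP[] := valP f. Qed.

Lemma dual_continuous (f : dual) : continuous (f : X -> R^o).
Proof. by have /asboolP[] := valP f. Qed.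

HB.instance Definition _ (f : dual) :=
  GRing.isLinear.Build R X R^o *:%R (f : X -> R^o) (dual_linear f).

Definition dual_norm (f : dual) : R :=
  sup [set `|f x : R| | x in [set x : X | `|x| <= 1]].

Lemma dual_bounded (f : dual) :
  exists2 M : R, 0 < M & forall x, `|f x| <= M * `|x|.
Proof.
have /linear_boundedP/pinfty_ex_gt0[M M0 fM] :=
  (linear_bounded_continuous f).2 (@dual_continuous f).
by exists M.
Qed.

Lemma dual_norm_has_sup (f : dual) :
  has_sup [set `|f x : R| | x in [set x : X | `|x| <= 1]].
Proof.
split; first by exists `|f 0|; exists 0 => //=; rewrite normr0.
have [M M0 fM] := dual_bounded f.
exists M => _ [x /= x1 <-]; apply: le_trans (fM x) _.
by rewrite -[leRHS]mulr1 ler_pM2l.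
Qed.

Lemma dual_norm_ub (f : dual) (x : X) : `|f x| <= dual_norm f * `|x|.
Proof.
have [->|x0] := eqVneq x 0; first by rewrite linear0 !normr0 mulr0.
have nx : 0 < `|x| by rewrite normr_gt0.
rewrite -ler_pdivrMr//; apply: ub_le_sup; first by case: (dual_norm_has_sup f).
exists (`|x|^-1 *: x) => /=.
  by rewrite normrZ gtr0_norm ?invr_gt0// mulVf// gt_eqF.
by rewrite linearZ/= normrM gtr0_norm ?invr_gt0// mulrC.
Qed.

Lemma dual_norm_le (f : dual) (M : R) :
  (forall x, `|x| <= 1 -> `|f x| <= M) -> dual_norm f <= M.
Proof.
move=> fM; apply: ge_sup; first by case: (dual_norm_has_sup f).
by move=> _ [x /= x1 <-]; exact: fM.
Qed.

Lemma dual_norm_ge0 (f : dual) : 0 <= dual_norm f.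
Proof.
apply: ub_le_sup; first by case: (dual_norm_has_sup f).
by exists 0; rewrite /= ?normr0// linear0 normr0.
Qed.

Lemma dual_normD (f g : dual) :
  dual_norm (f + g) <= dual_norm f + dual_norm g.
Proof.
apply: dual_norm_le => x x1.
have -> : (f + g) x = f x + g x by [].
apply: le_trans (ler_normD _ _) _.
apply: lerD; apply: le_trans (dual_norm_ub _ _) _;
  by rewrite -[leRHS]mulr1 ler_wpM2l// dual_norm_ge0.
Qed.

Lemma dual_normZ (a : R) (f : dual) : dual_norm (a *: f) = `|a| * dual_norm f.
Proof.
have le b g : dual_norm (b *: g) <= `|b| * dual_norm g.
  apply: dual_norm_le => x x1.
  have -> : (b *: g) x = b * g x by [].
  rewrite normrM ler_wpM2l//; apply: le_trans (dual_norm_ub _ _) _.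
  by rewrite -[leRHS]mulr1 ler_wpM2l// dual_norm_ge0.
apply/eqP; rewrite eq_le le/=.
have [->|a0] := eqVneq a 0; first by rewrite normr0 mul0r dual_norm_ge0.
rewrite -ler_pdivlMl ?normr_gt0// -normfV.
by apply: le_trans (le _ _); rewrite scalerA mulVf// scale1r.
Qed.

Lemma dual_norm0_eq0 (f : dual) : dual_norm f = 0 -> f = 0.
Proof.
move=> f0; apply: val_inj; apply/funext => x /=; apply/eqP.
by rewrite -normr_le0; apply: le_trans (dual_norm_ub _ _) _; rewrite f0 mul0r.
Qed.

HB.instance Definition _ :=
  Lmodule_isNormed.Build R dual dual_normD dual_normZ dual_norm0_eq0.

End Dual.

Section Reflexive.
Context {R : realType} (X : normedModType R).

Definition eval_at (x : X) : dual X -> R^o := fun f => f x.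

Lemma eval_at_dual (x : X) : eval_at x \in @dual_pred R (dual X).
Proof.
apply/asboolP; have lx : linear (eval_at x) by [].
split=> //.
pose L := GRing.isLinear.Build R (dual X) R^o *:%R (eval_at x) lx.
pose F : {linear dual X -> R^o} := HB.pack (eval_at x) L.
apply: (bounded_linear_continuous (f := F)); apply/linear_boundedP.
near=> r => f; rewrite mulrC; apply: le_trans (dual_norm_ub _ _) _.
by apply: ler_wpM2l; [exact: dual_norm_ge0 | near: r; exact: nbhs_pinfty_ge].
Unshelve. all: by end_near. Qed.

Definition bidual_embedding (x : X) : dual (dual X) := Dual (eval_at_dual x).

Definition reflexive_space : Prop :=
  forall F : dual (dual X), exists x : X, bidual_embedding x = F.

End Reflexive.

(* Coordinates are indexed by [nat]: the index [k] stands for the [k+1]-st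
   coordinate of the sequence (sequences being numbered from 1), so that
   [basis R k] is the basis vector e_(k+1).  All other indices (those of the
   parameters m, n, s and of the families K_n^j, the positions in special
   sequences) keep their mathematical values. *)

Section C00.
Context (R : realType).

Definition c00_pred : {pred nat -> R^o} :=
  fun x => `[< finite_set [set k | x k != 0] >].

Lemma c00_submod_closed : submod_closed c00_pred.
Proof.
split.
  apply/asboolP; apply: (@sub_finite_set _ _ set0) => // k /= /eqP.
  by case.
move=> a x y /asboolP fx /asboolP fy; apply/asboolP.
apply: (@sub_finite_set _ _ ([set k | x k != 0] `|` [set k | y k != 0])).
  move=> k /=; have [xk|] := eqVneq (x k) 0; last by left.
  have -> : (a *: x + y) k = a * x k + y k by [].
  by rewrite xk mulr0 add0r; right.
by rewrite finite_setU.
Qed.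

HB.instance Definition _ :=
  GRing.isSubmodClosed.Build R (nat -> R^o) c00_pred c00_submod_closed.

Record c00 := C00 { c00_val :> nat -> R^o; _ : c00_val \in c00_pred }.

HB.instance Definition _ := [isSub for c00_val].
HB.instance Definition _ := [Choice of c00 by <:].
HB.instance Definition _ := [SubChoice_isSubLmodule of c00 by <:].

Lemma basis_c00 (i : nat) : (fun k => (k == i)%:R : R^o) \in c00_pred.
Proof.
apply/asboolP; apply: (@sub_finite_set _ _ [set i]) => // k /=.
by case: (k =P i) => // _ /eqP; case.
Qed.

Definition basis (i : nat) : c00 := C00 (basis_c00 i).

Lemma restrict_c00 (E : set nat) (x : c00) :
  patch (fun=> 0) E (x : nat -> R^o) \in c00_pred.
Proof.
case: x => x /= /asboolP fx; apply/asboolP; apply: sub_finite_set fx => k /=.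
by rewrite /patch; case: ifP => //; rewrite eqxx.
Qed.

Definition restrict_to (E : set nat) (x : c00) : c00 := C00 (restrict_c00 E x).

End C00.

Section Sequences.
Context {R : realType}.
Implicit Types (x f : c00 R) (A B E : set nat).

Definition pairing f x : R := \sum_(k \in [set: nat]) f k * x k.

Definition sup_norm x : R := sup [set `|x k : R| | k in [set: nat]].

Definition supp x : set nat := [set k | x k != 0].

Definition range_of x : set nat :=
  [set k | exists a b, [/\ supp x a, supp x b & (a <= k <= b)%N]].

(* Intervals may be infinite; the empty one only produces the zero functional. *)
Definition nat_interval E : Prop :=
  forall a b k, E a -> E b -> (a <= k <= b)%N -> E k.

Definition set_before A B : Prop := forall a b, A a -> B b -> (a < b)%N.

(* The condition is imposed on all pairs, not only on consecutive ones: the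
   two agree for nonzero vectors, but zero is an element of the norming set
   and must not separate two vectors which are not successive. *)
Definition successive (fs : seq (c00 R)) : Prop :=
  forall i j, (i < j < size fs)%N ->
    set_before (supp (nth 0 fs i)) (supp (nth 0 fs j)).

End Sequences.

Record parameters (m n s : nat -> nat) : Prop := IsParameters {
  parameters_gt0 : forall j, (0 < j)%N -> [&& 0 < m j, 0 < n j & 0 < s j]%N;
  parameters_m1 : m 1%N = 2%N;
  parameters_mS : forall j, (0 < j)%N -> m j.+1 = (m j ^ 5)%N;
  parameters_n1 : n 1%N = 4%N;
  parameters_nS : forall j, (0 < j)%N -> n j.+1 = ((4 * n j) ^ s j)%N;
  parameters_s : forall j, (0 < j)%N -> (m j.+1 ^ 3 <= 2 ^ s j)%N
}.

Section Coding.
Context {R : realType}.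

Definition Q : set (c00 R) :=
  [set x | [/\ supp x !=set0,
               forall k, exists q : rat, x k = ratr q
             & forall k, `|x k : R| <= 1]].

(* (x_1, f_1, ..., x_d, f_d) is encoded as [:: (x_1, f_1); ...; (x_d, f_d)]. *)
Definition pair_seq := seq (c00 R * c00 R).

Definition pair_range (p : c00 R * c00 R) : set nat :=
  range_of p.1 `|` range_of p.2.

Definition Qs : set pair_seq :=
  [set phi | [/\ phi <> [::],
                 forall p, p \in phi -> Q p.1 /\ Q p.2
               & forall i, (i.+1 < size phi)%N ->
                   set_before (pair_range (nth (0, 0) phi i))
                              (pair_range (nth (0, 0) phi i.+1))]].

(* In the last clause, [k.+1] is the actual position of the coordinate [k]. *)
Record coding (m : nat -> nat) (sigma : pair_seq -> nat) : Prop := Coding {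
  coding_even : forall phi, Qs phi ->
    exists2 j, (0 < j)%N & sigma phi = (2 * j)%N;
  coding_inj : {in Qs &, injective sigma};
  coding_increasing : forall phi p, phi <> [::] -> Qs (rcons phi p) ->
    (sigma phi < sigma (rcons phi p))%N;
  coding_large : forall phi p, Qs (rcons phi p) ->
    forall k, pair_range p k ->
      k.+1%:R <= Num.sqrt (m (sigma (rcons phi p)))%:R :> R
}.

End Coding.

Arguments pair_seq : clear implicits.

Section NormingSet.
Context {R : realType} (m n : nat -> nat) (sigma : pair_seq R -> nat).
Implicit Types (phi : pair_seq R) (x f g : c00 R).

(* The i-th vector and the i-th functional of [phi], with i >= 1. *)
Definition xs phi (i : nat) : c00 R := (nth (0, 0) phi i.-1).1.
Definition fs phi (i : nat) : c00 R := (nth (0, 0) phi i.-1).2.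

Definition sig phi (i : nat) : nat := sigma (take i phi).

Definition basis_average (p : nat) x f : Prop :=
  exists A : seq nat, [/\ uniq A, size A = n p,
    x = (n p)%:R^-1 *: \sum_(l <- A) basis R l &
    f = (m p)%:R^-1 *: \sum_(l <- A) basis R l].

Record special (k : nat) phi : Prop := Special {
  special_Qs : Qs phi;
  special_size : size phi = (2 * k)%N;
  special_first : exists j, [/\ (0 < j)%N,
    (2 * k)%:R < Num.sqrt (m (2 * j))%:R :> R &
    basis_average (2 * j) (xs phi 1) (fs phi 1)];
  special_even : forall i, (1 <= i <= k)%N ->
    sup_norm (fs phi (2 * i)) <= (m (sig phi (2 * i - 1)))%:R^-1 /\
    `|pairing (fs phi (2 * i)) (xs phi (2 * i))|
      <= (m (sig phi (2 * i - 1)))%:R^-1;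
  special_odd : forall i, (1 <= i < k)%N ->
    basis_average (sig phi (2 * i)) (xs phi (2 * i + 1)) (fs phi (2 * i + 1))
}.

(* A family [L : nat -> set (c00 R)] stands for the sets K_n^j, j >= 0, at a
   fixed level n. *)
Definition all_types (L : nat -> set (c00 R)) : set (c00 R) :=
  \bigcup_(j in [set: nat]) L j.

Definition K0 (j : nat) : set (c00 R) :=
  if j == 0%N then [set f | exists i, f = basis R i \/ f = - basis R i]
  else set0.

Definition even_op (L : nat -> set (c00 R)) (j : nat) : set (c00 R) :=
  [set f | exists gs : seq (c00 R), [/\ (0 < size gs <= n j)%N,
     successive gs, forall g, g \in gs -> all_types L g &
     f = (m j)%:R^-1 *: \sum_(g <- gs) g]].

Definition odd_coef (j : nat) phi (i : nat) f (lam : R) : Prop :=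
  let x := xs phi (2 * i) in
  if pairing f x != 0 then lam = pairing f ((m (sig phi (2 * i - 1)))%:R *: x)
  else lam = ((n j)%:R ^+ 2)^-1 \/ lam = - ((n j)%:R ^+ 2)^-1.

(* [f'] and [lam] are only relevant at the indices 1 <= i <= (n j)./2, where
   [f' i] is the functional f'_(2i) and [lam i] its coefficient. *)
Definition odd_op_special (L : nat -> set (c00 R)) (j : nat) phi :
    set (c00 R) :=
  [set f | exists (eps : R) (E : set nat) (f' : nat -> c00 R) (lam : nat -> R),
     [/\ eps = 1 \/ eps = - 1,
         nat_interval E,
         forall i, (1 <= i <= (n j)./2)%N ->
           [/\ L (sig phi (2 * i - 1)) (f' i),
               supp (f' i) = supp (fs phi (2 * i)),
               forall g, L (sig phi (2 * i - 1)) g ->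
                 `|pairing g (xs phi (2 * i))|
                   <= (m (sig phi (2 * i - 1)))%:R^-1
             & odd_coef j phi i (f' i) (lam i)]
       & f = (eps / (m j)%:R) *: restrict_to E
               (\sum_(1 <= i < (n j)./2.+1)
                  (lam i *: fs phi (2 * i - 1) + f' i))]].

Definition odd_op (L : nat -> set (c00 R)) (j : nat) : set (c00 R) :=
  [set f | exists phi, [/\ special (n j)./2 phi, size phi = n j,
     forall i, (1 <= i <= (n j)./2)%N ->
       L (sig phi (2 * i - 1)) (fs phi (2 * i)) &
     odd_op_special L j phi f]].

(* The types 0 and 1 are never enlarged: K_n^0 = K_0, and the odd types are
   the 2j+1 with j >= 1, so that K_n^1 = K_0^1 is empty. *)
Definition K_step (L : nat -> set (c00 R)) (j : nat) : set (c00 R) :=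
  if (j <= 1)%N then L j
  else if odd j then L j `|` odd_op L j
  else L j `|` even_op L j.

Definition K_level (l j : nat) : set (c00 R) := iter l K_step K0 j.

Definition K : set (c00 R) := \bigcup_(l in [set: nat]) all_types (K_level l).

Definition norm_K x : R := sup [set pairing f x | f in K].

End NormingSet.

(* The completion of (V, N), which is unique up to isometric isomorphism, is
   any Banach space containing V isometrically as a dense subspace. *)
Record is_completion {R : realType} (V : lmodType R) (N : V -> R)
    (X : completeNormedModType R) (iota : {linear V -> X}) : Prop :=
  IsCompletion {
    completion_isometry : forall v, `|iota v| = N v;
    completion_dense : dense (range iota)
  }.

(* Main.v *)
From HB Require Import structures.
From mathcomp Require Import all_boot all_order all_algebra.
From mathcomp Require Import all_classical all_reals all_analysis.
From mathcomp Require Import ring lra zify.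
Require Import Defs.

Set Implicit Arguments.
Unset Strict Implicit.
Unset Printing Implicit Defensive.

Import Order.TTheory GRing.Theory Num.Theory.
Import numFieldNormedType.Exports.

Local Open Scope classical_set_scope.
Local Open Scope ring_scope.

(** By the theorem of James, a Banach space with a basis that is shrinking and
    boundedly complete is reflexive. Here the proof of that theorem is short:
    an element [F] of the bidual has coordinates [F e_k^*], the norm of the
    initial sums of the corresponding formal series is controlled by that of
    [F] because a norming set of finitely supported functionals is available,
    bounded completeness makes the series converge, and the shrinking property
    identifies its sum with [F]
    ([shrinking_boundedly_complete_reflexive]).

    The basis is boundedly complete because of the even operations. If the
    partial sums of a series are bounded but not Cauchy, there are functionals
    in [K] carried by successive segments, each giving at least [e] on the
    series. Then [n j] of them, multiplied by [1 / m j], form an element of [K]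
    whose value on the partial sums is at least [e * n j / m j >= e * m j],
    which is unbounded ([normK_boundedly_complete]).

    For the shrinking property no estimate on rapidly increasing sequences is
    needed. All that matters about an element of [K] that is not a signed basis
    vector is that it is [1 / m j <= 1 / 2] times a sum of at most [n j]
    successive functionals of norm at most one, and that its coordinates are
    bounded by [1 / m j] ([K_weighted]); this holds for the even and the odd
    operations alike. Suppose that a functional [phi] has norm at most [c] on a
    tail, and norm larger than [7 / 8 * c] on every later tail. Then there are
    vectors [v_k] of the unit ball, supported further and further, with
    [phi v_k >= 7 / 8 * c], hence no convex combination of them has norm below
    [7 / 8]. But some convex combination has norm at most [3 / 4]. Indeed, let
    [f] be in [K] with factor [1 / m j], and average [p] successive [v_k], with
    [p] much larger than [n j]: most of the [v_k] meet only one of the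
    successive pieces of [f], and so [f] is at most about [1 / 2] on the
    average. If on the other hand [m j] is large, [f] is small on any given
    vector because its coordinates are small. Choosing a few such averages, one
    after the other and over longer and longer blocks, every [f] is covered by
    one of the two reasons on all of the averages except perhaps one
    ([weighted_blocks]). So the norm of [phi] on tails can be decreased by the
    factor [7 / 8] again and again, and tends to zero
    ([weighted_shrinking]). *)

(** * Finitely supported sequences and their duality *)

(* Unfolding these during simplification would hide the terms that the rewrite
   rules for coordinates match. *)
Arguments c00_val : simpl never.
Arguments basis : simpl never.
Arguments restrict_to : simpl never.

Section FinitelySupported.
Context {R : realType}.
Implicit Types (f g x y v : c00 R) (E : set nat).

Lemma c00_ext x y : (forall k, x k = y k) -> x = y.
Proof. by move=> xy; apply: val_inj; apply/funext. Qed.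

Lemma c00E0 k : (0 : c00 R) k = 0. Proof. by []. Qed.

Lemma c00ED x y k : (x + y) k = x k + y k. Proof. by []. Qed.

Lemma c00EN x k : (- x) k = - x k. Proof. by []. Qed.

Lemma c00EZ (a : R) x k : (a *: x) k = a * x k. Proof. by []. Qed.

Lemma c00_sumE (I : Type) (r : seq I) (P : pred I) (F : I -> c00 R) k :
  (\sum_(i <- r | P i) F i) k = \sum_(i <- r | P i) F i k.
Proof. by elim/big_rec2: _ => // i y1 y2 _ <-. Qed.

Lemma basisE i k : basis R i k = (k == i)%:R. Proof. by []. Qed.

Lemma restrictE E x k :
  restrict_to E x k = if k \in E then x k else 0.
Proof. by []. Qed.

Lemma c00_bounded x : exists B, forall k, (B <= k)%N -> x k = 0.
Proof.
have /asboolP/finite_seqP[s xs] := valP x.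
exists (\max_(i <- s) i).+1 => k Bk.
apply/eqP/negPn/negP => xk; move: Bk; apply/negP; rewrite -ltnNge ltnS.
apply: leq_bigmax_seq => //.
by have : [set` s] k by rewrite -xs.
Qed.

Lemma pairingE f x B : (forall k, (B <= k)%N -> f k * x k = 0) ->
  pairing f x = \sum_(k < B) f k * x k.
Proof.
move=> fx; rewrite /pairing (fsbig_ord _ _ (fun k => f k * x k)).
symmetry; apply: fsbig_widen => //= k [_] /= /negP; rewrite -leqNgt.
exact: fx.
Qed.

Lemma pairingC f x : pairing f x = pairing x f.
Proof. by apply: eq_fsbigr => k _; rewrite mulrC. Qed.

Lemma pairing_linear f : linear (pairing f : c00 R -> R^o).
Proof.
move=> a x y; have [B fB] := c00_bounded f.
rewrite !(@pairingE _ _ B)=> [|k /fB ->|k /fB ->|k /fB ->]; rewrite ?mul0r//.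
rewrite scaler_sumr -big_split/=; apply: eq_bigr => k _.
by transitivity (f k * (a * x k + y k)) => //; rewrite mulrDr mulrCA.
Qed.

HB.instance Definition _ f :=
  GRing.isLinear.Build R (c00 R) R^o *:%R (pairing f) (pairing_linear f).

Lemma pairingDr f x y : pairing f (x + y) = pairing f x + pairing f y.
Proof. exact: linearD. Qed.

Lemma pairingZr f (a : R) x : pairing f (a *: x) = a * pairing f x.
Proof. exact: linearZ. Qed.

Lemma pairingNr f x : pairing f (- x) = - pairing f x.
Proof. exact: linearN. Qed.

Lemma pairing0r f : pairing f 0 = 0.
Proof. exact: linear0. Qed.

Lemma pairing_sumr (I : Type) (r : seq I) (P : pred I) (F : I -> c00 R) f :
  pairing f (\sum_(i <- r | P i) F i) = \sum_(i <- r | P i) pairing f (F i).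
Proof. exact: linear_sum. Qed.

Lemma pairingDl f g x : pairing (f + g) x = pairing f x + pairing g x.
Proof. by rewrite ![pairing _ x]pairingC pairingDr. Qed.

Lemma pairingZl f (a : R) x : pairing (a *: f) x = a * pairing f x.
Proof. by rewrite ![pairing _ x]pairingC pairingZr. Qed.

Lemma pairingNl f x : pairing (- f) x = - pairing f x.
Proof. by rewrite ![pairing _ x]pairingC pairingNr. Qed.

Lemma pairing0l x : pairing 0 x = 0.
Proof. by rewrite pairingC pairing0r. Qed.

Lemma pairing_suml (I : Type) (r : seq I) (P : pred I) (F : I -> c00 R) x :
  pairing (\sum_(i <- r | P i) F i) x = \sum_(i <- r | P i) pairing (F i) x.
Proof.
by rewrite pairingC pairing_sumr; apply: eq_bigr => i _; rewrite pairingC.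
Qed.

Lemma pairing_disjoint f x : (forall k, f k * x k = 0) -> pairing f x = 0.
Proof. by move=> fx; rewrite (@pairingE _ _ 0) ?big_ord0. Qed.

Lemma pairing_basisr f i : pairing f (basis R i) = f i.
Proof.
rewrite (@pairingE _ _ i.+1) => [|k ik].
  rewrite big_ord_recr/= basisE eqxx mulr1 big1 ?add0r// => k _.
  by rewrite basisE ltn_eqF// mulr0.
by rewrite basisE gtn_eqF// mulr0.
Qed.

Lemma pairing_restrict E f x :
  pairing (restrict_to E f) x = pairing f (restrict_to E x).
Proof.
by apply: eq_fsbigr => k _; rewrite !restrictE; case: ifP; rewrite ?mul0r ?mulr0.
Qed.

Lemma restrict_is_linear E : linear (@restrict_to R E).
Proof.
move=> a x y; apply: c00_ext => k.
by rewrite c00ED c00EZ !restrictE; case: ifP => // _; rewrite mulr0 addr0.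
Qed.

HB.instance Definition _ E := GRing.isLinear.Build R (c00 R) (c00 R) *:%R
  (restrict_to E) (restrict_is_linear E).

Definition partial_sum (a : nat -> R) (n : nat) : c00 R :=
  \sum_(k < n) a k *: basis R k.

Lemma partial_sumE a n k : partial_sum a n k = if (k < n)%N then a k else 0.
Proof.
elim: n => [|n IHn]; rewrite /partial_sum ?big_ord0// big_ord_recr/=.
rewrite c00ED IHn c00EZ basisE ltnS [(k <= n)%N]leq_eqVlt.
case: (eqVneq k n) => [->|kn] /=; first by rewrite ltnn add0r mulr1.
by rewrite mulr0 addr0.
Qed.

Lemma partial_sum_coord x n :
  partial_sum x n = restrict_to [set k | (k < n)%N] x.
Proof.
apply: c00_ext => k; rewrite partial_sumE restrictE.
suff -> : (k \in [set k | (k < n)%N]) = (k < n)%N by [].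
by apply/idP/idP; rewrite inE.
Qed.

End FinitelySupported.

(** * Successive families *)

Section Successive.
Context {R : realType}.
Implicit Types (f g h x y u v : c00 R) (gs vs : seq (c00 R)).

Definition tail_supported (n : nat) v : Prop := forall k, (k < n)%N -> v k = 0.

Lemma tail_supportedW n p v :
  (n <= p)%N -> tail_supported p v -> tail_supported n v.
Proof. by move=> np pv k kn; apply: pv; apply: leq_trans np. Qed.

Lemma successive_cons g gs :
  (forall h, h \in gs -> set_before (supp g) (supp h)) ->
  successive gs -> successive (g :: gs).
Proof.
move=> ggs sgs [|i] [|j]//= ij; last exact: sgs.
by apply: ggs; rewrite mem_nth.
Qed.

Lemma successive_behead g gs : successive (g :: gs) -> successive gs.
Proof. by move=> sgs i j ij; exact: (sgs i.+1 j.+1). Qed.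

Lemma successive_head g gs h :
  successive (g :: gs) -> h \in gs -> set_before (supp g) (supp h).
Proof.
move=> sgs /(nthP 0)[i ilt <-]; exact: (sgs 0%N i.+1).
Qed.

Lemma successive_tail_supported n v vs :
  (forall k, (n <= k)%N -> v k = 0) ->
  (forall u, u \in vs -> tail_supported n u) ->
  successive vs -> successive (v :: vs).
Proof.
move=> vn vsn; apply: successive_cons => u /vsn un a b /= /eqP va /eqP ub.
have an : (a < n)%N by rewrite ltnNge; apply/negP => /vn.
by apply: leq_trans an _; rewrite leqNgt; apply/negP => /un.
Qed.

Lemma successive_sum_le gs (c : R) k : 0 <= c -> successive gs ->
  (forall g, g \in gs -> `|g k| <= c) -> `|(\sum_(g <- gs) g) k| <= c.
Proof.
move=> c0; elim: gs => [|g gs IH] sgs gc; first by rewrite big_nil c00E0 normr0.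
rewrite big_cons c00ED; have [gk|gk] := eqVneq (g k) 0.
  rewrite gk add0r; apply: IH; first exact: successive_behead sgs.
  by move=> h hgs; apply: gc; rewrite inE hgs orbT.
rewrite c00_sumE big1_seq ?addr0 ?gc ?mem_head// => h /= hgs.
apply/eqP/negPn/negP => hk.
by have := successive_head sgs hgs gk hk; rewrite ltnn.
Qed.

(** Running through both families as in a merge of sorted lists, each step
    discards one vector or one functional, which has at most one nonzero
    pairing with what is left; so at most [size gs + size vs] of all the
    pairings are nonzero. *)
Lemma successive_pairing_le gs vs : successive gs -> successive vs ->
  (forall g v, g \in gs -> v \in vs -> `|pairing g v| <= 1) ->
  `|pairing (\sum_(g <- gs) g) (\sum_(v <- vs) v)| <= (size gs + size vs)%:R.
Proof.
elim: gs vs => [|g gs IHg] vs sg.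
  by move=> _ _; rewrite big_nil pairing0l normr0 ler0n.
elim: vs => [|v vs IHv] sv gv; first by rewrite big_nil pairing0r normr0 ler0n.
have [[w [wvs [a ga wa]]]|none] := pselect (exists w, w \in vs /\
    exists2 a, g a != 0 & w a != 0).
- (* The first functional goes beyond [v], so that the later ones miss [v]. *)
  rewrite [X in pairing _ X]big_cons pairingDr addrC.
  apply: le_trans (ler_normD _ _) _; rewrite /= addnS -natr1 lerD//.
    apply: IHv; first exact: successive_behead sv.
    by move=> h u hg uv; apply: gv => //; rewrite inE uv orbT.
  rewrite big_cons pairingDl pairing_suml big1_seq ?addr0 ?gv ?mem_head//.
  move=> h /= hgs; apply: pairing_disjoint => k; apply/eqP.
  rewrite mulf_eq0; apply/negPn/negP; rewrite negb_or => /andP[hk vk].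
  have := successive_head sg hgs ga hk.
  by rewrite ltnNge ltnW//; exact: (successive_head sv wvs vk wa).
- (* The first functional misses all the vectors after [v]. *)
  rewrite [X in pairing X _]big_cons pairingDl.
  apply: le_trans (ler_normD _ _) _.
  rewrite /= addSn -natr1 addrC lerD//; last first.
    rewrite big_cons pairingDr pairing_sumr big1_seq ?addr0 ?gv ?mem_head//.
    move=> w /= wvs; apply: pairing_disjoint => k; apply/eqP.
    rewrite mulf_eq0; apply/negPn/negP; rewrite negb_or => /andP[gk wk].
    by apply: none; exists w; split=> //; exists k.
  apply: (IHg (v :: vs)) => //; first exact: successive_behead sg.
  by move=> h u hg uv; apply: gv => //; rewrite inE hg orbT.
Qed.

End Successive.

Section Averages.
Context {R : realType}.
Implicit Types (f g h x y u v : c00 R) (gs vs : seq (c00 R)).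

Definition average vs : c00 R := (size vs)%:R^-1 *: \sum_(v <- vs) v.

Definition average_closed (V : set (c00 R)) : Prop :=
  forall vs, vs <> [::] -> (forall v, v \in vs -> V v) -> V (average vs).

Definition reaches_far (V : set (c00 R)) : Prop :=
  forall n, exists2 v, V v & tail_supported n v.

Lemma reaches_far_successive (V : set (c00 R)) (n p : nat) : reaches_far V ->
  exists vs, [/\ size vs = p, successive vs, forall v, v \in vs -> V v &
    forall v, v \in vs -> tail_supported n v].
Proof.
move=> Vfar; elim: p n => [|p IHp] n.
  by exists [::]; split=> // i j; rewrite andbF.
have [v Vv vn] := Vfar n; have [B vB] := c00_bounded v.
have [vs [vsp svs Vvs vsn]] := IHp (maxn n B).
exists (v :: vs); split=> [||u|u] /=; first by rewrite vsp.
- apply: (@successive_tail_supported _ B) => // u /vsn.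
  by apply: tail_supportedW; rewrite leq_maxr.
- by rewrite inE => /orP[/eqP -> //|]; exact: Vvs.
- rewrite inE => /orP[/eqP -> //|/vsn].
  by apply: tail_supportedW; rewrite leq_maxl.
Qed.

Lemma average_tail_supported vs n :
  (forall v, v \in vs -> tail_supported n v) -> tail_supported n (average vs).
Proof.
move=> vsn k kn; rewrite c00EZ c00_sumE big1_seq ?mulr0// => v /= /vsn.
exact.
Qed.

Lemma l1_bound v : exists2 C : R, 0 <= C &
  forall f (c : R), (forall k, `|f k| <= c) -> `|pairing f v| <= c * C.
Proof.
have [B vB] := c00_bounded v.
exists (\sum_(k < B) `|v k|); first exact: sumr_ge0.
move=> f c fc; rewrite (@pairingE _ _ _ B) => [|k /vB ->]; last by rewrite mulr0.
apply: le_trans (ler_norm_sum _ _ _) _; rewrite mulr_sumr; apply: ler_sum => k _.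
by rewrite normrM ler_wpM2r.
Qed.

End Averages.

(** * Norms defined by weighted functionals are shrinking *)

Record norming {R : realType} (N : c00 R -> R) (W : set (c00 R)) : Prop :=
  Norming {
    norming_le : forall f v, W f -> `|pairing f v| <= N v;
    norming_sup : forall v c, (forall f, W f -> pairing f v <= c) -> N v <= c
  }.

(** The functionals on a completion are the extensions of the functionals on
    finitely supported sequences that are bounded for [N]; hence this property
    of the basis of the completion, like [boundedly_complete] below, can be
    expressed before completing. *)
Definition shrinking {R : realType} (N : c00 R -> R) : Prop :=
  forall (phi : {linear c00 R -> R^o}) (C : R),
    (forall v, `|phi v| <= C * N v) -> forall e, 0 < e ->
  exists n, forall v, tail_supported n v -> `|phi v| <= e * N v.

Section NormingFacts.
Context {R : realType} (N : c00 R -> R) (W : set (c00 R)).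
Hypothesis NW : norming N W.

Lemma norming_ge0 v : 0 <= N v.
Proof.
rewrite leNgt; apply/negP => Nv.
have : N v <= N v - 1; last by lra.
apply: (norming_sup NW) => f Wf.
by have := norming_le NW v Wf; have := normr_ge0 (pairing f v); lra.
Qed.

Lemma normingZ (a : R) v : N (a *: v) <= `|a| * N v.
Proof.
apply: (norming_sup NW) => f Wf; rewrite pairingZr.
apply: le_trans (ler_norm _) _; rewrite normrM ler_wpM2l//.
exact: (norming_le NW).
Qed.

Lemma norming_average vs : vs <> [::] -> (forall v, v \in vs -> N v <= 1) ->
  N (average vs) <= 1.
Proof.
move=> vs0 vs1; apply: (norming_sup NW) => f Wf.
rewrite pairingZr pairing_sumr mulrC.
rewrite ler_pdivrMr ?ltr0n ?lt0n ?size_eq0; last exact/eqP.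
rewrite mul1r -sum1_size natr_sum big_seq [leRHS]big_seq.
apply: ler_sum => v vvs; apply: le_trans (ler_norm _) _.
exact: le_trans (norming_le NW v Wf) (vs1 v vvs).
Qed.

End NormingFacts.

(** The functionals produced by a mixed Tsirelson operation: the factor [w j]
    in front of at most [d j] successive functionals of norm at most one. The
    bound on the coordinates makes those of large index harmless on any given
    vector. *)
Definition weighted {R : realType} (N : c00 R -> R) (w : nat -> R)
    (d : nat -> nat) (j : nat) (f : c00 R) : Prop :=
  (forall k, `|f k| <= w j) /\
  exists gs, [/\ (size gs <= d j)%N, successive gs,
    forall g, g \in gs -> forall v, `|pairing g v| <= N v &
    f = w j *: \sum_(g <- gs) g].

Section WeightedNorms.
Context {R : realType} (N : c00 R -> R) (W : set (c00 R)).
Context (w : nat -> R) (d : nat -> nat).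
Hypothesis NW : norming N W.
Hypothesis w_ge0 : forall j, 0 <= w j.
Hypothesis w_small : forall e, 0 < e -> exists J, forall j, (J <= j)%N -> w j <= e.
Hypothesis W_weighted : forall f, W f ->
  (exists i, f = basis R i \/ f = - basis R i) \/
  (exists j, w j <= 2^-1 /\ weighted N w d j f).

Section FarSets.
Variable V : set (c00 R).
Hypothesis V_average : average_closed V.
Hypothesis V_far : reaches_far V.
Hypothesis V_ball : forall v, V v -> N v <= 1.

(** On a long average, most vectors meet a single one of the at most [D] pieces
    of the functional, and only the factor [w j <= 1 / 2] remains. *)
Lemma weighted_average_le n D : exists y, [/\ V y, tail_supported n y &
  forall j f, (d j <= D)%N -> w j <= 2^-1 -> weighted N w d j f ->
    `|pairing f y| <= 9 / 16].
Proof.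
(* At most [D + p] pairings are nonzero, and [(D + p) / (2 p) <= 9 / 16] as
   soon as [8 D <= p]. *)
pose p := (8 * D + 8)%N.
have [vs [vsp svs Vvs vsn]] := reaches_far_successive n p V_far.
exists (average vs); split.
- by apply: V_average => // vs0; move: vsp; rewrite vs0 /p /=; lia.
- exact: average_tail_supported.
move=> j f dD w2 [_ [gs [gsd sgs gs1 ->]]].
rewrite pairingZl pairingZr vsp !normrM (ger0_norm (w_ge0 j)).
have G : `|pairing (\sum_(g <- gs) g) (\sum_(v <- vs) v)| <= D%:R + p%:R.
  rewrite -natrD; apply: le_trans (successive_pairing_le sgs svs _) _.
    by move=> g v hg hv; apply: le_trans (gs1 g hg v) (V_ball (Vvs v hv)).
  by rewrite vsp ler_nat leq_add2r (leq_trans gsd).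
have p0 : 0 < p%:R :> R by rewrite ltr0n /p; lia.
have pD : 8 * D%:R + 8 = p%:R :> R by rewrite /p natrD natrM.
rewrite ger0_norm ?invr_ge0 ?ler0n// mulrCA mulrC ler_pdivrMr//.
apply: le_trans (ler_pM (w_ge0 j) (normr_ge0 _) w2 G) _.
lra.
Qed.

(** The vectors of the list are built one after the other as longer and longer
    averages. A weighted functional of index [j] is larger than [9 / 16] on at
    most one of them: it is small on the earlier ones because its coordinates
    are tiny compared with their l1-norms, and on the later ones because they
    average many more than [d j] vectors. The clause about [j < J], where no
    exceptional vector occurs, is what the induction needs to add a vector in
    front. *)
Lemma weighted_blocks M n J : exists zs : seq (c00 R),
  [/\ size zs = M, forall z, z \in zs -> V z,
      forall z, z \in zs -> tail_supported n z,
      forall j f, (j < J)%N -> w j <= 2^-1 -> weighted N w d j f ->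
        \sum_(z <- zs) `|pairing f z| <= 9 / 16 * M%:R
    & forall f, W f -> \sum_(z <- zs) `|pairing f z| <= 1 + 9 / 16 * M%:R].
Proof.
elim: M n J => [|M IHM] n J.
  by exists [::]; split=> // *; rewrite big_nil mulr0 ?addr0.
pose D := \max_(j < J) d j.
have dD j : (j < J)%N -> (d j <= D)%N.
  by move=> jJ; apply: (leq_bigmax (Ordinal jJ)).
have [y [Vy yn ysmall]] := weighted_average_le n D.
have [B yB] := c00_bounded y; have [C C0 yC] := l1_bound y.
have [J0 wJ0] := @w_small (9 / 16 / (C + 1)) ltac:(apply: divr_gt0; lra).
(* From [J0] on the coordinates are small enough for [y]; below it, the rest of
   the list has to be prepared by the induction hypothesis. *)
have [zs [zsM Vzs zsn zsmall zsW]] := IHM (maxn n B) (maxn J J0).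
exists (y :: zs); split=> [|z|z|j f jJ w2 jf|f Wf].
- by rewrite /= zsM.
- by rewrite inE => /orP[/eqP -> //|]; exact: Vzs.
- rewrite inE => /orP[/eqP -> //|/zsn].
  by apply: tail_supportedW; rewrite leq_maxl.
- rewrite big_cons -[M.+1%:R]natr1 mulrDr mulr1 addrC lerD//.
    by apply: (zsmall j) => //; rewrite leq_max jJ.
  by apply: (ysmall j) => //; exact: dD.
rewrite big_cons -[M.+1%:R]natr1.
have fy : `|pairing f y| <= 1 := le_trans (norming_le NW y Wf) (V_ball Vy).
have fzs := zsW f Wf.
have [[i fi]|[j [w2 jf]]] := W_weighted Wf.
  have fE x : `|pairing f x| = `|x i|.
    by case: fi => ->; rewrite ?pairingNl ?normrN pairingC pairing_basisr.
  have [iB|Bi] := ltnP i B; last by rewrite fE yB// normr0; lra.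
  rewrite [X in _ + X]big1_seq => [|z /= /zsn zn].
    by have := ler0n R M; lra.
  by rewrite fE zn ?normr0// leq_max iB orbT.
have [jJ|Jj] := ltnP j (maxn J J0).
  by have := zsmall j f jJ w2 jf; lra.
suff : `|pairing f y| <= 9 / 16 by lra.
apply: le_trans (yC _ _ jf.1) _.
have := wJ0 j (leq_trans (leq_maxr _ _) Jj).
rewrite ler_pdivlMr; last by lra.
by have := w_ge0 j; nra.
Qed.

Lemma exists_small_average : exists2 z, V z & N z <= 3 / 4.
Proof.
(* Eight vectors suffice: [(1 + 8 * 9 / 16) / 8 = 11 / 16]. *)
have [zs [zs8 Vzs _ _ zsW]] := weighted_blocks 8 0 0.
exists (average zs); first by apply: V_average => // zs0; move: zs8; rewrite zs0.
apply: (norming_sup NW) => f Wf; rewrite pairingZr pairing_sumr zs8.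
have : \sum_(z <- zs) pairing f z <= 1 + 9 / 16 * 8.
  apply: le_trans (zsW f Wf); apply: ler_sum => z _; exact: ler_norm.
lra.
Qed.

End FarSets.

(** Otherwise the vectors of the unit ball on which [phi] is at least
    [7 / 8 * c] reach arbitrarily far, and some average of them has norm at
    most [3 / 4]; but there [phi] is at most [3 / 4 * c]. *)
Lemma tail_norm_contraction (phi : {linear c00 R -> R^o}) (c : R) n : 0 < c ->
  (forall v, tail_supported n v -> `|phi v| <= c * N v) ->
  exists p, forall v, tail_supported p v -> `|phi v| <= 7 / 8 * c * N v.
Proof.
move=> c0 phic; apply: contrapT => /forallNP noP.
pose V := [set v | [/\ tail_supported n v, N v <= 1 & 7 / 8 * c <= phi v]].
have [] := @exists_small_average V.
- move=> vs vs0 Vvs; split.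
  + by apply: average_tail_supported => v /Vvs[].
  + by apply: (norming_average NW) => // v /Vvs[].
  + rewrite linearZ linear_sum/= [leRHS]mulrC.
    rewrite ler_pdivlMr ?ltr0n ?lt0n ?size_eq0; last exact/eqP.
    rewrite -sum1_size natr_sum mulr_sumr big_seq [leRHS]big_seq.
    by apply: ler_sum => v /Vvs[_ _]; rewrite mulr1.
- move=> p; have /existsNP[v /not_implyP[vp /negP]] := noP (maxn n p).
  rewrite -ltNge => phiv.
  have {phiv vp} [u [up uphi]] : exists u, tail_supported (maxn n p) u /\
      7 / 8 * c * N u < phi u.
    have [phi0|phi0] := leP 0 (phi v); first by exists v; rewrite -(ger0_norm phi0).
    exists (- v); split; first by move=> k kp; rewrite c00EN vp ?oppr0.
    rewrite linearN -(ltr0_norm phi0); apply: le_lt_trans phiv.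
    rewrite ler_wpM2l//; first by nra.
    by rewrite -scaleN1r; apply: le_trans (normingZ NW _ _) _; rewrite normrN1 mul1r.
  have un : tail_supported n u := tail_supportedW (leq_maxl n p) up.
  have Nu : 0 < N u.
    rewrite lt_neqAle (norming_ge0 NW) andbT; apply/eqP => Nu.
    by have := phic u un; rewrite -Nu mulr0 in uphi *; have := ler_norm (phi u); lra.
  exists ((N u)^-1 *: u); last first.
    by move=> k kp; rewrite c00EZ up ?mulr0// leq_max kp orbT.
  split.
  + by move=> k kp; rewrite c00EZ un ?mulr0.
  + apply: le_trans (normingZ NW _ _) _.
    by rewrite gtr0_norm ?invr_gt0// mulVf// gt_eqF.
  + by rewrite linearZ/= [leRHS]mulrC ler_pdivlMr// ltW.
- by move=> v [].
- move=> z [zn z1 phiz] z34.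
  have := phic z zn; have := ler_norm (phi z); nra.
Qed.

Lemma weighted_shrinking : shrinking N.
Proof.
move=> phi C phiC e e0.
have [C1 C10 phiC1] : exists2 c : R, 0 < c & forall v, `|phi v| <= c * N v.
  exists (`|C| + 1) => [|v]; first by have := normr_ge0 C; lra.
  apply: le_trans (phiC v) _; rewrite ler_wpM2r ?(norming_ge0 NW)//.
  by have := ler_norm C; lra.
have geo k : exists n, forall v, tail_supported n v ->
    `|phi v| <= (7 / 8) ^+ k * C1 * N v.
  elim: k => [|k [n IHk]]; first by exists 0%N => v _; rewrite mul1r.
  have [|p phip] := @tail_norm_contraction phi ((7 / 8) ^+ k * C1) n _ IHk.
    by rewrite mulr_gt0// exprn_gt0//; lra.
  by exists p => v /phip; rewrite exprS !mulrA.
have [k ke] : exists k, (7 / 8) ^+ k * C1 <= e.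
  have /cvgrPdist_le/(_ (e / C1)) : (fun k => (7 / 8 : R) ^+ k) @ \oo --> (0 : R).
    by apply: cvg_expr; rewrite ger0_norm; lra.
  rewrite divr_gt0// => /(_ isT) [k _ /(_ k (leqnn k))] /=.
  rewrite sub0r normrN ger0_norm ?exprn_ge0//.
  by rewrite ler_pdivlMr// => ke; exists k.
have [n phin] := geo k; exists n => v /phin; move/le_trans; apply.
by rewrite ler_wpM2r ?(norming_ge0 NW).
Qed.

End WeightedNorms.

(** * Shrinking and boundedly complete bases give reflexive completions *)

Definition boundedly_complete {R : realType} (N : c00 R -> R) : Prop :=
  forall (a : nat -> R) (C : R), (forall n, N (partial_sum a n) <= C) ->
    forall e, 0 < e -> exists n0, forall n, (n0 <= n)%N ->
      N (partial_sum a n - partial_sum a n0) <= e.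

Section Completion.
Context {R : realType} (N : c00 R -> R) (X : completeNormedModType R).
Context (iota : {linear c00 R -> X}).
Hypothesis hX : is_completion N iota.

Lemma completion_approx (x : X) (e : R) : 0 < e -> exists v, `|x - iota v| < e.
Proof.
move=> e0; have [||y [xy [v _ vy]]] := @completion_dense _ _ _ _ _ hX (ball x e).
- by exists x; exact: ballxx.
- exact: ball_open.
- by exists v; rewrite vy; move: xy; rewrite -ball_normE.
Qed.

Lemma dual_le_dense (h : dual X) (c : R) : 0 <= c ->
  (forall v, `|h (iota v)| <= c * N v) -> forall x, `|h x| <= c * `|x|.
Proof.
move=> c0 hc x; apply/ler_addgt0Pr => e e0.
have M0 := dual_norm_ge0 h.
have [|v xv] := @completion_approx x (e / (dual_norm h + c + 1)).
  by apply: divr_gt0 => //; lra.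
move: xv; rewrite ltr_pdivlMr => [xv|]; last by lra.
have h1 := dual_norm_ub h (x - iota v).
rewrite linearB/= in h1.
have h2 := hc v; rewrite -(completion_isometry hX) in h2.
have h3 : `|iota v| <= `|x| + `|x - iota v|.
  by rewrite -[X in `|X| <= _](subKr x); apply: ler_normB.
have h4 : `|h x| <= `|h x - h (iota v)| + `|h (iota v)|.
  by rewrite -{1}(subrK (h (iota v)) (h x)); apply: ler_normD.
have := normr_ge0 (x - iota v); nra.
Qed.

(** The supremum of [phi v - C * `|x - iota v|] over [v] is the smallest
    extension of [phi] with Lipschitz constant [C]. This explicit formula makes
    no choice of approximating sequences; density then forces the extension to
    be linear. *)
Lemma dual_extension (phi : {linear c00 R -> R^o}) (C : R) : 0 <= C ->
  (forall v, `|phi v| <= C * N v) ->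
  exists g : dual X, forall v, g (iota v) = phi v.
Proof.
move=> C0 phiC.
pose S x : set R := [set phi v - C * `|x - iota v| | v in [set: c00 R]].
have SE x v w : phi v - C * `|x - iota v| <= phi w + C * `|x - iota w|.
  have : phi v - phi w <= C * `|iota v - iota w|.
    rewrite -linearB -linearB/= (completion_isometry hX).
    by apply: le_trans (phiC _); exact: ler_norm.
  have : `|iota v - iota w| <= `|x - iota v| + `|x - iota w|.
    by rewrite -[iota v - _](subrKA x) (distrC x (iota v)); apply: ler_normD.
  by nra.
pose E x : R := sup (S x).
have EP x w : `|E x - phi w| <= C * `|x - iota w|.
  rewrite ler_distl; apply/andP; split.
    apply: ub_le_sup; last by exists w.
    by exists (phi w + C * `|x - iota w|) => _ [v _ <-].
  apply: ge_sup; first by exists (phi w - C * `|x - iota w|); exists w.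
  by move=> _ [v _ <-].
have E_lin : linear (E : X -> R^o).
  move=> b x y; apply/eqP; rewrite -subr_eq0 -normr_le0.
  apply/ler_addgt0Pr => e e0; rewrite add0r.
  pose K := 2 * C * (`|b| + 1) + 1.
  have b0 := normr_ge0 b.
  have K0 : 0 < K by rewrite /K; nra.
  have [v xv] := @completion_approx x (e / K) (divr_gt0 e0 K0).
  have [w yw] := @completion_approx y (e / K) (divr_gt0 e0 K0).
  have Ev := EP x v; have Ew := EP y w; have Evw := EP (b *: x + y) (b *: v + w).
  have D : `|b *: x + y - iota (b *: v + w)| <=
      `|b| * `|x - iota v| + `|y - iota w|.
    by rewrite linearP opprD addrACA -scalerBr -normrZ; apply: ler_normD.
  rewrite linearP/= in Evw.
  have bEv : `|b * (E x - phi v)| <= `|b| * (C * `|x - iota v|).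
    by rewrite normrM ler_wpM2l.
  rewrite (_ : _ - _ = (E (b *: x + y) - (b * phi v + phi w)) -
    b * (E x - phi v) - (E y - phi w)); last first.
    by rewrite -[b *: (E x : R^o)]/(b * E x); ring.
  apply: le_trans (ler_normB _ _) _.
  apply: le_trans (lerD (ler_normB _ _) (lexx _)) _.
  have xv0 := normr_ge0 (x - iota v); have yw0 := normr_ge0 (y - iota w).
  have CD := ler_wpM2l C0 D.
  suff : 2 * C * (`|b| * `|x - iota v| + `|y - iota w|) <= e.
    rewrite mulrDr in CD; move: CD bEv Ev Ew Evw.
    by rewrite -[b *: (phi v : R^o)]/(b * phi v); lra.
  have Kr : K * (e / K) = e by rewrite mulrC divfK ?gt_eqF.
  have := ler_wpM2l b0 (ltW xv) => bxv.
  have : 2 * C * (`|b| * `|x - iota v| + `|y - iota w|) <=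
      2 * C * (`|b| * (e / K) + e / K).
    by apply: ler_wpM2l; [lra | exact: lerD bxv (ltW yw)].
  have := divr_gt0 e0 K0; rewrite {1}/K in Kr; nra.
have E_iota v : E (iota v) = phi v.
  by apply/eqP; rewrite -subr_eq0 -normr_le0 (le_trans (EP _ v))// subrr normr0 mulr0.
have E_cont : continuous (E : X -> R^o).
  pose L := GRing.isLinear.Build R X R^o *:%R (E : X -> R^o) E_lin.
  pose F : {linear X -> R^o} := HB.pack (E : X -> R^o) L.
  apply: (bounded_linear_continuous (f := F)); apply/linear_boundedP.
  near=> r => x; have := EP x 0.
  rewrite (linear0 phi) (linear0 iota) (subr0 x) (subr0 (E x)) => /le_trans; apply.
  by apply: ler_wpM2r => //; near: r; exact: nbhs_pinfty_ge.
have E_dual : (E : X -> R^o) \in @dual_pred R X by apply/asboolP.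
by exists (Dual E_dual).
Unshelve. all: by end_near.
Qed.

End Completion.

Section Reflexivity.
Context {R : realType} (N : c00 R -> R) (W : set (c00 R)).
Context (X : completeNormedModType R) (iota : {linear c00 R -> X}).
Hypothesis NW : norming N W.
Hypothesis N_head : forall n (v : c00 R), N (partial_sum v n) <= N v.
Hypothesis W_basis : forall k, W (basis R k).
Hypothesis hX : is_completion N iota.

Lemma shrinking_boundedly_complete_reflexive :
  shrinking N -> boundedly_complete N -> reflexive_space X.
Proof.
move=> sh bc F.
have coord k : exists g : dual X, forall v, g (iota v) = v k.
  have [||g gE] := @dual_extension _ _ _ _ hX (pairing (basis R k)) 1 _ _ => //.
    by move=> v; rewrite mul1r; apply: (norming_le NW).
  by exists g => v; rewrite gE -pairing_basisr; exact: pairingC.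
have [es esE] := choice coord.
pose a k : R := F (es k).
have comb_iota (b : nat -> R) n v :
    (\sum_(k < n) b k *: es k : dual X) (iota v) = \sum_(k < n) b k * v k.
  under [RHS]eq_bigr do rewrite -esE.
  elim/big_rec2: _ => // k y1 y2 _ <-.
  by [].
have comb_F (G : dual (dual X)) (b : nat -> R) n :
    G (\sum_(k < n) b k *: es k) = \sum_(k < n) b k * G (es k).
  by rewrite linear_sum; apply: eq_bigr => k _; rewrite linearZ.
have pairing_partial (f : c00 R) (b : nat -> R) n :
    pairing f (partial_sum b n) = \sum_(k < n) f k * b k.
  rewrite pairing_sumr; apply: eq_bigr => k _.
  by rewrite pairingZr pairing_basisr mulrC.
(* The value of [f] on the partial sum is the value of [F] on the initial part
   of [f], a functional of norm at most one. *)
have a_bounded n : N (partial_sum a n) <= dual_norm F.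
  apply: (norming_sup NW) => f Wf; rewrite pairing_partial -comb_F.
  apply: le_trans (ler_norm _) _; apply: le_trans (dual_norm_ub _ _) _.
  rewrite -[leRHS]mulr1 ler_wpM2l ?dual_norm_ge0//.
  apply: dual_norm_le => x x1; apply: le_trans x1; rewrite -[leRHS]mul1r.
  apply: (dual_le_dense hX) => // v; rewrite comb_iota mul1r -pairing_partial.
  by apply: le_trans (norming_le NW _ Wf) (N_head _ _).
have [x xlim] : exists x : X, (fun n => iota (partial_sum a n)) @ \oo --> x.
  suff /cauchy_cvgP : cauchy ((fun n => iota (partial_sum a n)) @ \oo).
    by move=> cv; exists (lim ((fun n => iota (partial_sum a n)) @ \oo)).
  apply: cauchy_exP => e e0.
  have [n0 n0e] := bc a _ a_bounded (e / 2) ltac:(lra).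
  exists (iota (partial_sum a n0)); exists n0 => // n /= /n0e.
  rewrite -(completion_isometry hX) linearB/= -ball_normE/= distrC => /le_lt_trans.
  by apply; lra.
have es_x k : es k x = a k.
  apply/eqP; rewrite -subr_eq0 -normr_le0; apply/ler_addgt0Pr => e e0.
  rewrite add0r; have M0 := dual_norm_ge0 (es k).
  have /cvgrPdist_lt/(_ (e / (dual_norm (es k) + 1))) := xlim.
  rewrite divr_gt0 ?ltr_wpDl// => /(_ isT) [p _ /(_ (maxn p k.+1))].
  rewrite /= leq_maxl => /(_ isT).
  rewrite ltr_pdivlMr ?ltr_wpDl// => xp.
  have := dual_norm_ub (es k) (x - iota (partial_sum a (maxn p k.+1))).
  rewrite linearB/= esE partial_sumE leq_maxr => /le_trans; apply.
  by have := normr_ge0 (x - iota (partial_sum a (maxn p k.+1))); nra.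
exists x; apply/eqP; rewrite -subr_eq0; apply/eqP.
set G := _ - _.
have G0 k : G (es k) = 0.
  by transitivity (es k x - F (es k)) => //; rewrite es_x subrr.
apply: val_inj; apply/funext => g; apply/eqP; rewrite -normr_le0.
apply/ler_addgt0Pr => e e0; rewrite add0r.
have M0 := dual_norm_ge0 G.
pose d := e / (2 * (dual_norm G + 1)).
have d0 : 0 < d by apply: divr_gt0 => //; lra.
have [|n gn] := sh (g \o iota) (dual_norm g) _ d d0.
  by move=> v; rewrite -(completion_isometry hX); exact: dual_norm_ub.
(* [G] vanishes on the [es], so that [g] may be replaced by its remainder [h],
   which only sees the tails of vectors and has small norm. *)
pose b k : R := g (iota (basis R k)).
pose h : dual X := g - \sum_(k < n) b k *: es k.
have -> : val G g = G h.
  transitivity (G g - G (\sum_(k < n) b k *: es k)); last exact/esym/linearB.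
  by rewrite comb_F big1 ?subr0// => k _; rewrite G0 mulr0.
have hE v : h (iota v) = g (iota (v - partial_sum v n)).
  transitivity (g (iota v) - (\sum_(k < n) b k *: es k : dual X) (iota v)) => //.
  rewrite comb_iota linearB [RHS]linearB; congr (_ - _).
  rewrite /partial_sum linear_sum [RHS]linear_sum; apply: eq_bigr => k _.
  by rewrite linearZ [RHS]linearZ [RHS]mulrC.
have NB (v : c00 R) p : N (v - partial_sum v p) <= 2 * N v.
  rewrite -!(completion_isometry hX) linearB.
  apply: le_trans (ler_normB _ _) _; rewrite !(completion_isometry hX).
  by have := N_head p v; lra.
have h_small : dual_norm h <= 2 * d.
  have d20 : 0 <= 2 * d by lra.
  apply: dual_norm_le => y y1.
  apply: le_trans (dual_le_dense hX (c := 2 * d) d20 _ y) _ => [v|].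
    rewrite hE; apply: le_trans (gn _ _) _.
      by move=> k kn; rewrite c00ED c00EN partial_sumE kn subrr.
    by have := NB v n; nra.
  by rewrite -[leRHS]mulr1 ler_wpM2l.
apply: le_trans (dual_norm_ub _ _) _.
apply: le_trans (ler_wpM2l M0 h_small) _.
have : d * (2 * (dual_norm G + 1)) = e by rewrite /d divfK// gt_eqF//; lra.
by nra.
Qed.

End Reflexivity.

(** * The norming set *)

Section Growth.
Context (m n s : nat -> nat) (hpar : parameters m n s).

Lemma parameters_m_gt j : (0 < j)%N -> (j < m j)%N.
Proof.
elim: j => // -[_ _|j IHj _]; first by rewrite (parameters_m1 hpar).
rewrite (parameters_mS hpar)//; have := IHj isT; move: (m j.+1) => k jk.
by apply: (leq_ltn_trans jk); rewrite -{1}[k]expn1 ltn_exp2l//; lia.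
Qed.

(** The growth of [n] gives much more; a bound making [n j / m j] tend to
    infinity suffices for bounded completeness. *)
Lemma parameters_m_sqr j : (0 < j)%N -> (m j ^ 2 <= n j)%N.
Proof.
case: j => // -[_|j _]; first by rewrite (parameters_m1 hpar) (parameters_n1 hpar).
rewrite (parameters_nS hpar)//.
have sj := parameters_s hpar (ltn0Sn j).
have /and3P[_ n0 s0] := parameters_gt0 hpar (ltn0Sn j).
have mS0 : (0 < m j.+2)%N by have := parameters_m_gt (ltn0Sn j.+1); lia.
apply: (@leq_trans ((m j.+2 ^ 3) ^ 2)); first by rewrite -expnM leq_pexp2l.
apply: (@leq_trans ((2 ^ s j.+1) ^ 2)); first by rewrite leq_sqr.
by rewrite -expnM mulnC expnM leq_exp2r//; lia.
Qed.

End Growth.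

Section Restriction.
Context {R : realType}.
Implicit Types (f g x : c00 R) (E : set nat).

Lemma restrict_restrict E1 E2 x :
  restrict_to E1 (restrict_to E2 x) = restrict_to (E1 `&` E2) x.
Proof.
apply: c00_ext => k; rewrite !restrictE in_setI.
by case: (k \in E1); case: (k \in E2).
Qed.

Lemma restrict_setT x : restrict_to setT x = x.
Proof. by apply: c00_ext => k; rewrite restrictE in_setT. Qed.

Lemma restrict_basis E i :
  restrict_to E (basis R i) = if i \in E then basis R i else 0.
Proof.
apply: c00_ext => k; rewrite restrictE [in LHS]basisE.
case: (eqVneq k i) => [->|ki]; first by case: ifP; rewrite ?basisE ?eqxx.
by rewrite if_same; case: ifP; rewrite ?c00E0// basisE (negbTE ki).
Qed.

Lemma supp_restrict E x : supp (restrict_to E x) `<=` supp x.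
Proof. by move=> k; rewrite /supp /= restrictE; case: ifP => // _ /eqP. Qed.

Lemma nat_intervalI E1 E2 :
  nat_interval E1 -> nat_interval E2 -> nat_interval (E1 `&` E2).
Proof.
by move=> I1 I2 a b k [a1 a2] [b1 b2] akb; split; [exact: I1 akb | exact: I2 akb].
Qed.

Lemma nat_interval_co a b : nat_interval [set k | (a <= k < b)%N].
Proof. by move=> i j k /=; lia. Qed.

Lemma successive_map_filter (F : c00 R -> c00 R) (p : pred (c00 R)) gs :
  (forall g, supp (F g) `<=` supp g) -> successive gs ->
  successive [seq F g | g <- gs & p g].
Proof.
move=> Fs; elim: gs => [|g gs IH] sgs /=; first exact: sgs.
have sgs' := IH (successive_behead sgs).
case: ifP => // _; apply: successive_cons => // h /mapP[h0].
rewrite mem_filter => /andP[_ h0gs] -> a b /Fs ga /Fs hb.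
exact: (successive_head sgs h0gs ga hb).
Qed.

End Restriction.

Section NormingSet.
Context {R : realType} (m n s : nat -> nat) (sigma : pair_seq R -> nat).
Hypothesis hpar : parameters m n s.
Hypothesis hsigma : coding m sigma.
Implicit Types (f g h x v : c00 R) (phi : pair_seq R).
Local Notation K := (K m n sigma).
Local Notation K_level := (K_level m n sigma).
Local Notation K_step := (K_step m n sigma).
Local Notation normK := (norm_K m n sigma).

Lemma K_levelW l l' j f : (l <= l')%N -> K_level l j f -> K_level l' j f.
Proof.
move=> /subnKC <-; elim: (l' - l)%N => [|i IHi]; first by rewrite addn0.
move=> /IHi; rewrite addnS; move: (l + i)%N => p pf.
rewrite /K_level iterS -/(K_level p) /K_step.
by case: ifP => // _; case: ifP => _; left.
Qed.

Lemma K_levelE l j f : K_level l.+1 j f -> K_level l j f \/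
  (1 < j)%N /\ (if odd j then odd_op m n sigma (K_level l) j f
                else even_op m n (K_level l) j f).
Proof.
rewrite /K_level iterS -/(K_level l) /K_step.
case: leqP => [_|j1]; first by left.
by case: ifP => _ [|]; [left | right | left | right].
Qed.

Lemma K_level_in l j f : K_level l j f -> K f.
Proof. by move=> lf; exists l => //; exists j. Qed.

Lemma K_even l j f : (0 < j)%N -> ~~ odd j -> even_op m n (K_level l) j f ->
  K_level l.+1 j f.
Proof.
move=> j0 /negbTE jodd jf; rewrite /K_level iterS -/(K_level l) /K_step jodd.
by case: leqP => [j1|_]; [move: jodd; have -> : j = 1%N by lia | right].
Qed.

Lemma K_basis k : K (basis R k).
Proof. by apply: (@K_level_in 0 0); exists k; left. Qed.

Lemma K_level_opp l j f : K_level l j f -> K_level l j (- f).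
Proof.
elim: l j f => [|l IHl] j f.
  rewrite /K_level /= /K0; case: eqP => // _ [i [->|->]]; exists i; first by right.
  by left; rewrite opprK.
move=> /K_levelE[/IHl/(K_levelW (leqnSn l))//|[j1]].
case: ifPn => jodd.
  move=> [phi [sphi phin phiL [eps [E [f' [lam [eps1 Eint H ->]]]]]]].
  rewrite /K_level iterS -/(K_level l) /K_step leqNgt j1 jodd/=; right.
  exists phi; split=> //; exists (- eps), E, f', lam; split=> //.
    by case: eps1 => ->; [right | left; rewrite opprK].
  by rewrite mulNr scaleNr.
move=> [gs [gsn sgs gsL ->]]; apply: K_even => //; first exact: ltnW.
exists [seq - g | g <- gs & predT g]; split.
- by rewrite filter_predT size_map.
- apply: (@successive_map_filter _ -%R) => // g k.
  by rewrite /supp /= c00EN oppr_eq0.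
- move=> _ /mapP[g +] ->; rewrite filter_predT => /gsL[i _ ig].
  by exists i => //; exact: IHl.
- by rewrite filter_predT big_map sumrN scalerN.
Qed.

Lemma K_opp f : K f -> K (- f).
Proof. by move=> [l _ [j _ /K_level_opp]]; exact: K_level_in. Qed.

(** Cutting a tree of functionals by an interval cuts all its branches. The
    branches that disappear are dropped, since zero does not belong to all the
    sets [K_level l j]. *)
Lemma K_level_restrict l j f E : nat_interval E -> K_level l j f ->
  restrict_to E f = 0 \/ K_level l j (restrict_to E f).
Proof.
move=> Eint; elim: l j f => [|l IHl] j f.
  rewrite /K_level /= /K0; case: eqP => // _ [i [->|->]];
    rewrite ?linearN/= restrict_basis; case: ifP => _; rewrite ?oppr0; try by left.
    by right; exists i; left.
  by right; exists i; right.
move=> /K_levelE[/IHl[|/(K_levelW (leqnSn l))]|[j1]]; try by [left|right].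
case: ifPn => jodd.
  move=> [phi [sphi phin phiL [eps [E' [f' [lam [eps1 Eint' H ->]]]]]]]; right.
  rewrite /K_level iterS -/(K_level l) /K_step leqNgt j1 jodd/=; right.
  exists phi; split=> //; exists eps, (E `&` E'), f', lam; split=> //.
    exact: nat_intervalI.
  by rewrite linearZ/= restrict_restrict.
move=> [gs [/andP[gs0 gsn] sgs gsL ->]].
pose ngs := [seq restrict_to E g | g <- gs & restrict_to E g != 0].
have gsE : restrict_to E (\sum_(g <- gs) g) = \sum_(g <- ngs) g.
  rewrite linear_sum big_map big_filter [RHS]big_mkcond.
  by apply: eq_bigr => g _; case: eqVneq.
rewrite linearZ/= gsE; have [ngs0|ngs0] := posnP (size ngs).
  by left; rewrite (size0nil ngs0) big_nil scaler0.
right; apply: K_even => //; first exact: ltnW.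
exists ngs; split=> //.
- rewrite ngs0 (leq_trans _ gsn)// size_map size_filter; exact: count_size.
- by apply: successive_map_filter => // g; exact: supp_restrict.
- move=> _ /mapP[g +] ->; rewrite mem_filter => /andP[g0 /gsL[i _ ig]].
  by exists i => //; case: (IHl _ _ ig) => // /eqP; rewrite (negbTE g0).
Qed.

Lemma K_restrict f E : nat_interval E -> K f ->
  restrict_to E f = 0 \/ K (restrict_to E f).
Proof.
move=> Eint [l _ [j _ /(K_level_restrict Eint)[|H]]]; first by left.
by right; exact: K_level_in H.
Qed.

Lemma Qs_take phi i : Qs phi -> (0 < i)%N -> Qs (take i phi).
Proof.
move=> [phi0 phiQ phiB] i0; split=> [|p pt|k].
- by case: phi i i0 phi0 {phiQ phiB} => // a phi [].
- by apply: phiQ; apply: mem_take pt.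
- rewrite size_take_min leq_min => /andP[ki kphi].
  by rewrite !nth_take//; [exact: phiB | exact: ltnW].
Qed.

Lemma Qs_before phi i j : Qs phi -> (i < j < size phi)%N ->
  set_before (pair_range (nth (0, 0) phi i)) (pair_range (nth (0, 0) phi j)).
Proof.
move=> [_ phiQ phiB]; elim: j => // j IHj /andP[]; rewrite ltnS leq_eqVlt.
case: eqVneq => [-> _|ij /= ij' js]; first exact: phiB.
have [[[k kj] _ _] _] := phiQ _ (mem_nth (0, 0) (ltnW js)).
have kr : pair_range (nth (0, 0) phi j) k.
  by left; exists k, k; rewrite leqnn.
move=> a b ai bj; apply: ltn_trans (phiB j js k b kr bj).
by apply: IHj ai kr; rewrite ij' ltnW.
Qed.

Lemma K_basis_average p x f : (0 < p)%N -> ~~ odd p ->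
  basis_average m n p x f -> K f.
Proof.
move=> p0 podd [A [uA sA _ ->]]; apply: (@K_level_in 1 p); apply: K_even => //.
have /and3P[_ np0 _] := parameters_gt0 hpar p0.
exists [seq basis R i | i <- sort leq A]; split.
- by rewrite size_map size_sort sA np0 leqnn.
- move=> i j /andP[ij]; rewrite size_map => js a b.
  rewrite !(nth_map 0%N)//; last by apply: ltn_trans js.
  rewrite /supp/= !basisE !pnatr_eq0 !eqb0 => /negPn/eqP -> /negPn/eqP ->.
  apply: (sorted_ltn_nth ltn_trans 0%N) => //.
    by rewrite ltn_sorted_uniq_leq sort_uniq uA sort_sorted//; exact: leq_total.
  by rewrite inE; apply: ltn_trans js.
- move=> _ /mapP[i _ ->]; exists 0%N => //.
  by exists i; left.
- by rewrite big_map; congr (_ *: _); apply: perm_big; rewrite perm_sym perm_sort.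
Qed.

Lemma odd_sumE phi (f' : nat -> c00 R) (lam : nat -> R) p :
  \sum_(1 <= i < p.+1) (lam i *: fs phi (2 * i - 1) + f' i) =
  \sum_(0 <= q < 2 * p) (if odd q then 1 else lam q./2.+1) *:
     (if odd q then f' q./2.+1 else fs phi q.+1).
Proof.
elim: p => [|p IHp]; first by rewrite muln0 !big_geq.
rewrite big_nat_recr//= IHp mulnS addnC addn2 !big_nat_recr//= -addrA.
congr (_ + _); rewrite mul2n /= odd_double /= uphalf_double doubleK scale1r.
by congr (_ *: fs _ _ + _); lia.
Qed.

(** The shape of the summands in the even and odd operations. The coordinates
    of [h] are bounded separately because this bound for [K] is itself proved by
    induction on the levels. *)
Definition scaled_cut (g : c00 R) : Prop := exists (c : R) E h,
  [/\ `|c| <= 1, nat_interval E, K h, (forall k, `|h k| <= 1) &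
      g = c *: restrict_to E h].

Lemma odd_coef_le1 L j phi i f (lam : R) :
  (forall g, L g -> `|pairing g (xs phi (2 * i))|
                   <= (m (sig sigma phi (2 * i - 1)))%:R^-1) -> L f ->
  odd_coef m n sigma j phi i f lam -> `|lam| <= 1.
Proof.
move=> /[apply]; rewrite /odd_coef /=; case: ifP => _.
  move=> fx ->; rewrite pairingZr normrM ger0_norm//.
  apply: le_trans (ler_wpM2l _ fx) _ => //.
  by have [->|m0] := eqVneq ((m (sig sigma phi (2 * i - 1)))%:R : R) 0;
    rewrite ?mul0r// divff.
move=> _ H; have -> : `|lam| = ((n j)%:R ^+ 2)^-1.
  by case: H => ->; rewrite ?normrN ger0_norm// invr_ge0 exprn_ge0.
have [->|n0] := posnP (n j); first by rewrite expr0n invr0.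
by rewrite invf_le1 ?exprn_gt0 ?ltr0n// exprn_ege1// ler1n.
Qed.

(** The functionals of odd position in a special sequence are averages with an
    even index, which is imposed on the first one and is a value of the coding
    for the others; hence the even operation applied to basis vectors yields
    them. *)
Lemma special_odd_K k phi q : special m n sigma k phi -> (q < 2 * k)%N ->
  ~~ odd q -> K (fs phi q.+1).
Proof.
move=> sp qk qodd; have qE : q = (2 * q./2)%N by have := odd_double_half q; lia.
have [q0|q0] := posnP q./2.
  have [j [j0 _ fj]] := special_first sp.
  rewrite qE q0; apply: (K_basis_average _ _ fj); first by lia.
  by rewrite mul2n odd_double.
have := @special_odd _ _ _ _ _ _ sp q./2 ltac:(lia); rewrite /sig.
have [|j j0 ->] := @coding_even _ _ _ hsigma (take (2 * q./2) phi).
  by apply: Qs_take; [exact: special_Qs sp | lia].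
rewrite addn1 -qE; apply: K_basis_average; first by lia.
by rewrite mul2n odd_double.
Qed.

(** An odd functional is, like an even one, a sum of at most [n j] successive
    pieces: the [2 * (n j)./2] restricted terms follow the order of the special
    sequence, as [f' i] has the support of the functional it replaces. *)
Lemma odd_op_sum (L : nat -> set (c00 R)) j f :
  (forall i g, L i g -> K g /\ forall k, `|g k| <= 1) ->
  odd_op m n sigma L j f ->
  exists gs, [/\ (size gs <= n j)%N, successive gs,
    forall g, g \in gs -> scaled_cut g & f = (m j)%:R^-1 *: \sum_(g <- gs) g].
Proof.
move=> LK [phi [sp phin phiL [eps [E [f' [lam [eps1 Eint H ->]]]]]]].
have szphi := special_size sp; set p := (n j)./2 in sp phiL H szphi *.
pose c q : R := eps * (if odd q then 1 else lam q./2.+1).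
pose u q : c00 R := if odd q then f' q./2.+1 else fs phi q.+1.
have qp q : (q < 2 * p)%N -> (1 <= q./2.+1 <= p)%N by lia.
have u_supp q : (q < 2 * p)%N -> supp (u q) `<=` pair_range (nth (0, 0) phi q).
  move=> qlt; suff -> : supp (u q) = supp (nth (0, 0) phi q).2.
    by move=> k qk; right; exists k, k; rewrite leqnn.
  rewrite /u; case: ifP => // qodd; have [_ -> _ _] := H _ (qp q qlt).
  by rewrite /fs; congr (supp (nth _ _ _).2); lia.
exists (mkseq (fun q => c q *: restrict_to E (u q)) (2 * p)); split.
- by rewrite size_mkseq -phin szphi.
- move=> i i'; rewrite size_mkseq => /andP[ii' ip].
  rewrite !nth_mkseq//; last exact: ltn_trans ip.
  move=> a b; rewrite /supp /= !c00EZ => ai bi.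
  apply: (@Qs_before phi i i'); first exact: special_Qs sp.
  + by rewrite ii' szphi.
  + apply: u_supp; first exact: ltn_trans ip.
    by apply/(@supp_restrict _ E)/eqP => a0; move: ai; rewrite a0 mulr0 eqxx.
  + apply: u_supp => //.
    by apply/(@supp_restrict _ E)/eqP => b0; move: bi; rewrite b0 mulr0 eqxx.
- move=> _ /mapP[q +] ->; rewrite mem_iota add0n => /andP[_ qlt].
  have [f'L _ f'x f'lam] := H _ (qp q qlt).
  exists (c q), E, (u q); rewrite /c /u; split=> //.
  + rewrite normrM; have -> : `|eps| = 1 by case: eps1 => ->; rewrite ?normrN normr1.
    rewrite mul1r; case: ifP => _; first by rewrite normr1.
    exact: odd_coef_le1 f'x f'L f'lam.
  + by case: ifPn => [_|qodd]; [case: (LK _ _ f'L) | exact: special_odd_K sp _ _].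
  + case: ifPn => [_|qodd]; first by case: (LK _ _ f'L).
    have [_ phiQ _] := special_Qs sp.
    have qphi : (q < size phi)%N by rewrite szphi.
    have [_ [_ _ Q1]] := phiQ _ (mem_nth (0, 0) qphi).
    exact: Q1.
- rewrite odd_sumE big_map /index_iota subn0 mulrC -scalerA.
  congr (_ *: _); rewrite linear_sum scaler_sumr; apply: eq_bigr => q _.
  by rewrite linearZ/= scalerA.
Qed.


Lemma K_level_sum l j f :
  (forall i g, K_level l i g -> forall k, `|g k| <= 1) ->
  K_level l.+1 j f -> K_level l j f \/
  (1 < j)%N /\ exists gs, [/\ (size gs <= n j)%N, successive gs,
    forall g, g \in gs -> scaled_cut g & f = (m j)%:R^-1 *: \sum_(g <- gs) g].
Proof.
move=> L1 /K_levelE[|[j1]]; first by left.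
case: ifP => jodd jf; right; split=> //.
  by apply: odd_op_sum jf => i g ig; split; [exact: K_level_in ig | exact: L1 ig].
case: jf => gs [/andP[gs0 gsn] sgs gsL fE]; exists gs; split=> // g /gsL[i _ ig].
exists 1, setT, g; rewrite normr1 restrict_setT scale1r; split=> //.
  exact: K_level_in ig.
exact: L1 ig.
Qed.

Lemma scaled_cut_le1 g k : scaled_cut g -> `|g k| <= 1.
Proof.
move=> [c [E [h [c1 _ _ h1 ->]]]]; rewrite c00EZ normrM mulr_ile1//.
by rewrite restrictE; case: ifP; rewrite ?normr0.
Qed.

Lemma scaled_cut_sum_le j gs k : successive gs ->
  (forall g, g \in gs -> scaled_cut g) ->
  `|((m j)%:R^-1 *: \sum_(g <- gs) g : c00 R) k| <= (m j)%:R^-1.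
Proof.
move=> sgs gst; rewrite c00EZ normrM ger0_norm ?invr_ge0//.
rewrite -[leRHS]mulr1 ler_wpM2l ?invr_ge0//.
by apply: successive_sum_le => // g /gst; exact: scaled_cut_le1.
Qed.

Lemma invm_half j : (0 < j)%N -> (m j)%:R^-1 <= 2^-1 :> R.
Proof.
move=> j0; have := parameters_m_gt hpar j0; move: (m j) => p jp.
by rewrite lef_pV2 ?posrE ?ltr0n ?ler_nat//; lia.
Qed.

Lemma K_level_le1 l j f k : K_level l j f -> `|f k| <= 1.
Proof.
elim: l j f k => [|l IHl] j f k.
  rewrite /K_level /= /K0; case: eqP => // _ [i fi].
  have -> : `|f k| = `|basis R i k| by case: fi => ->; rewrite // c00EN normrN.
  by rewrite basisE; case: eqP; rewrite ?normr1 ?normr0.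
move=> /K_level_sum[i g ig k'|/IHl//|[j1 [gs [_ sgs gst ->]]]]; first exact: IHl ig.
apply: le_trans (scaled_cut_sum_le _ _ sgs gst) _.
by have := invm_half (ltnW j1); lra.
Qed.

Lemma K_le1 f k : K f -> `|f k| <= 1.
Proof. by move=> [l _ [j _]]; exact: K_level_le1. Qed.

Lemma normK_norming : norming normK K.
Proof.
have le f v : K f -> pairing f v <= normK v.
  move=> Kf; apply: ub_le_sup; last by exists f.
  have [C C0 vC] := l1_bound v; exists (1 * C) => _ [g Kg <-].
  by apply: le_trans (ler_norm _) (vC g 1 (fun k => K_le1 k Kg)).
split=> [f v Kf|v c vc].
  by rewrite ler_norml le// andbT lerNl -pairingNl; exact/le/K_opp.
apply: ge_sup => [|_ [f Kf <-]]; last exact: vc.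
by exists (pairing (basis R 0) v); exists (basis R 0) => //; exact: K_basis.
Qed.

Lemma K_restrict_le f v E : nat_interval E -> K f ->
  `|pairing (restrict_to E f) v| <= normK v.
Proof.
move=> Eint /(K_restrict Eint)[->|]; last exact: (norming_le normK_norming).
by rewrite pairing0l normr0 (norming_ge0 normK_norming).
Qed.

Lemma normK_head p v : normK (partial_sum v p) <= normK v.
Proof.
apply: (norming_sup normK_norming) => f Kf.
rewrite partial_sum_coord -pairing_restrict; apply: le_trans (ler_norm _) _.
by apply: K_restrict_le => // a b k /=; lia.
Qed.

Lemma scaled_cut_le g v : scaled_cut g -> `|pairing g v| <= normK v.
Proof.
move=> [c [E [h [c1 Eint Kh _ ->]]]]; rewrite pairingZl normrM.
have := @K_restrict_le h v E Eint Kh.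
have := normr_ge0 (pairing (restrict_to E h) v).
by have := normr_ge0 c; nra.
Qed.

(** Apart from the norm being the supremum over [K], this is the only
    information on the norming set that the shrinking property uses. *)
Lemma K_weighted f : K f -> (exists i, f = basis R i \/ f = - basis R i) \/
  (exists j, (m j)%:R^-1 <= 2^-1 :> R /\
     weighted normK (fun j => (m j)%:R^-1) n j f).
Proof.
move=> [l _ [j _]]; elim: l => [|l IHl].
  by rewrite /K_level /= /K0; case: eqP => // _; left.
move=> /K_level_sum[i g ig k|/IHl//|[j1 [gs [gsn sgs gst ->]]]].
  exact: K_level_le1 ig.
right; exists j; split; first by apply: invm_half; exact: ltnW.
split=> [k|]; first exact: scaled_cut_sum_le.
by exists gs; split=> // g /gst gg v; exact: scaled_cut_le.
Qed.

Lemma normK_shrinking : shrinking normK.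
Proof.
apply: (weighted_shrinking (w := fun j => (m j)%:R^-1) (d := n) normK_norming).
- by move=> j; rewrite invr_ge0.
- move=> e e0; exists (Num.truncn e^-1).+1 => j Jj.
  have mj := parameters_m_gt hpar (leq_trans (ltn0Sn _) Jj).
  rewrite -[leRHS]invrK lef_pV2 ?posrE ?invr_gt0 ?ltr0n ?(leq_trans _ mj)//.
  apply: ltW (lt_le_trans (truncnS_gt _) _).
  by rewrite ler_nat (leq_trans Jj)// ltnW.
- exact: K_weighted.
Qed.

Lemma K_common_level (gs : seq (c00 R)) : (forall g, g \in gs -> K g) ->
  exists l, forall g, g \in gs -> all_types (K_level l) g.
Proof.
elim: gs => [|g gs IHgs] gsK; first by exists 0%N.
have [|l gsl] := IHgs; first by move=> h hgs; apply: gsK; rewrite inE hgs orbT.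
have [l' _ [i _ gi]] := gsK g (mem_head _ _).
exists (maxn l l') => h; rewrite inE => /orP[/eqP ->|/gsl[i' _ hi']].
  by exists i => //; apply: K_levelW gi; rewrite leq_maxr.
by exists i' => //; apply: K_levelW hi'; rewrite leq_maxl.
Qed.

(** If the partial sums are not Cauchy, infinitely many successive segments
    have norm above [e]; each is seen by its own functional of the norming
    set, cut down to the segment. *)
Lemma not_cauchy_functionals (a : nat -> R) (e : R) : 0 < e ->
  (forall p, exists2 q, (p <= q)%N &
     e < normK (partial_sum a q - partial_sum a p)) ->
  forall d p, exists gs q, [/\ size gs = d, successive gs,
    forall g, g \in gs -> K g, forall g, g \in gs -> tail_supported p g &
    forall r, (q <= r)%N ->
      d%:R * e <= pairing (\sum_(g <- gs) g) (partial_sum a r)].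
Proof.
move=> e0 far; elim=> [|d IHd] p.
  exists [::], 0%N; split=> // [i j|r _]; first by rewrite andbF.
  by rewrite big_nil pairing0l mul0r.
have [q pq eq] := far p.
have [f Kf ef] : exists2 f, K f &
    e < pairing f (partial_sum a q - partial_sum a p).
  apply: contrapT => nof; move: eq; apply/negP; rewrite -leNgt.
  apply: (norming_sup normK_norming) => f Kf; rewrite leNgt; apply/negP => ef.
  by apply: nof; exists f.
pose E := [set k | (p <= k < q)%N].
have in_E k : (k \in E) = (p <= k < q)%N by apply/idP/idP; rewrite inE.
have gE r : (q <= r)%N -> pairing (restrict_to E f) (partial_sum a r) =
    pairing f (partial_sum a q - partial_sum a p).
  move=> qr; rewrite pairing_restrict; congr pairing; apply: c00_ext => k.
  rewrite restrictE in_E c00ED c00EN !partial_sumE.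
  case: (leqP p k) => pk; case: (ltnP k q) => kq /=; rewrite ?subr0 ?subrr//.
    by rewrite (leq_trans kq qr).
  lia.
have [gs [q' [gsd sgs gsK gsq ege]]] := IHd q.
have Kg : K (restrict_to E f).
  have [g0|//] := K_restrict (@nat_interval_co p q : nat_interval E) Kf.
  by have := gE q (leqnn q); rewrite g0 pairing0l => g0'; rewrite -g0' in ef; lra.
exists (restrict_to E f :: gs), (maxn q q'); split=> [||g|g|r].
- by rewrite /= gsd.
- apply: (@successive_tail_supported _ q) => // k qk.
  by rewrite restrictE in_E [(k < q)%N]ltnNge qk andbF.
- by rewrite inE => /orP[/eqP ->|/gsK].
- rewrite inE => /orP[/eqP -> k kp|/gsq]; last exact: tail_supportedW.
  by rewrite restrictE in_E leqNgt kp.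
- rewrite geq_max => /andP[qr q'r]; rewrite big_cons pairingDl gE//.
  by rewrite -natr1 mulrDl mul1r addrC lerD ?ege// ltW.
Qed.

Lemma normK_boundedly_complete : boundedly_complete normK.
Proof.
move=> a C aC e e0; apply: contrapT => nocv.
have far p : exists2 q, (p <= q)%N &
    e < normK (partial_sum a q - partial_sum a p).
  apply: contrapT => nop; apply: nocv; exists p => q pq.
  by rewrite leNgt; apply/negP => eq; apply: nop; exists q.
have [i Ci] : exists i, C < (m (2 * i.+1))%:R * e.
  exists (Num.truncn (C / e)); rewrite -ltr_pdivrMr//.
  apply: lt_le_trans (truncnS_gt _) _; rewrite ler_nat.
  by apply: leq_trans (ltnW (parameters_m_gt hpar _)); rewrite // leq_pmull.
set j := (2 * i.+1)%N in Ci.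
have j0 : (0 < j)%N by [].
have [gs [q [gsn sgs gsK _ /(_ q (leqnn q)) gsq]]] :=
  not_cauchy_functionals e0 far (n j) 0.
have [l gsl] := K_common_level gsK.
have Kf : K ((m j)%:R^-1 *: \sum_(g <- gs) g).
  apply: (@K_level_in l.+1 j); apply: K_even => //.
    by rewrite /j mul2n odd_double.
  exists gs; split=> //; rewrite gsn leqnn andbT.
  by case/and3P: (parameters_gt0 hpar j0).
have := le_trans (norming_le normK_norming (partial_sum a q) Kf) (aC q).
rewrite leNgt => /negP; apply; apply: lt_le_trans Ci _.
apply: le_trans (ler_norm _); rewrite pairingZl.
have m0 : 0 < (m j)%:R :> R by rewrite ltr0n; case/and3P: (parameters_gt0 hpar j0).
rewrite ler_pdivlMl//; apply: le_trans gsq.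
by rewrite mulrA ler_pM2r// -natrM ler_nat mulnn (parameters_m_sqr hpar).
Qed.

End NormingSet.

(** * Reflexivity *)

Theorem proposition4p10 (R : realType) (m n s : nat -> nat)
    (sigma : pair_seq R -> nat) (hpar : parameters m n s)
    (hsigma : coding m sigma) (Xius : completeNormedModType R)
    (iota : {linear c00 R -> Xius})
    (hX : is_completion (norm_K m n sigma) iota) :
  reflexive_space Xius.
Proof.
apply: (shrinking_boundedly_complete_reflexive (normK_norming hpar hsigma) _ _ hX).
- exact: (normK_head hpar hsigma).
- exact: K_basis.
- exact: (normK_shrinking hpar hsigma).
- exact: (normK_boundedly_complete hpar hsigma).
Qed.
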